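(* Let $X$ be a nonnegative random variable with finite moments $m_k=\mathbf{E}[X^k]$, $k=1,2,\ldots$, and $m_1>0$. Suppose there is a real number $a\ge 1$ such that $m_{k+1}/m_k=\mathcal{O}((k+1)^{2/a})$ as $k\to\infty$. Then the power $X^{\lfloor a\rfloor}$ satisfies Carleman's condition, $\sum_{k=1}^{\infty}\left(\mathbf{E}[(X^{\lfloor a\rfloor})^k]\right)^{-1/(2k)}=\infty$, and $X^{\lfloor a\rfloor}$ is M-det.
   Context: For a real number $a$, $\lfloor a\rfloor$ is the largest integer less than or equal to $a$. A nonnegative random variable with all moments finite is called M-det (moment determinate, in the sense of the Stieltjes moment problem) if its distribution is the only probability distribution on $[0,\infty)$ having its moment sequence. *)

(* Defs.v *)
From HB Require Import structures.
From mathcomp Require Import all_boot all_order all_algebra.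
From mathcomp Require Import all_classical all_reals all_analysis.
From mathcomp Require Import measurable_realfun.

Set Implicit Arguments.
Unset Strict Implicit.
Unset Printing Implicit Defensive.

Import Order.TTheory GRing.Theory Num.Theory.
Import numFieldNormedType.Exports.

Local Open Scope classical_set_scope.
Local Open Scope ring_scope.

Definition power_RV (d : measure_display) (T : measurableType d) (R : realType)
    (P : probability T R) (X : {RV P >-> R}) (n : nat) : T -> R :=
  fun t => X t ^+ n.

Lemma measurable_power_RV (d : measure_display) (T : measurableType d)
    (R : realType) (P : probability T R) (X : {RV P >-> R}) (n : nat) :
  measurable_fun [set: T] (power_RV X n).
Proof. exact/measurable_funX/measurable_funPT. Qed.

HB.instance Definition _ (d : measure_display) (T : measurableType d)
    (R : realType) (P : probability T R) (X : {RV P >-> R}) (n : nat) :=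
  isMeasurableFun.Build _ _ _ _ (power_RV X n) (measurable_power_RV X n).

Definition moment (d : measure_display) (T : measurableType d) (R : realType)
    (P : probability T R) (X : T -> R) (k : nat) : \bar R :=
  ('E_P[fun t => (X t ^+ k)%R])%E.

Definition nonneg_RV (d : measure_display) (T : measurableType d)
    (R : realType) (P : probability T R) (X : T -> R) : Prop :=
  {ae P, forall t, 0 <= X t}.

Definition finite_moments (d : measure_display) (T : measurableType d)
    (R : realType) (P : probability T R) (X : T -> R) : Prop :=
  forall k : nat, (1 <= k)%N ->
    P.-integrable [set: T] (fun t => (X t ^+ k)%:E).

(* m^(-1/(2k)) is written as an extended-real inverse so that it is +oo for
   m = 0 and 0 for m = +oo. The library's powers with a negative exponent give
   0 at 0 and +oo at +oo. *)
Definition carleman (d : measure_display) (T : measurableType d)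
    (R : realType) (P : probability T R) (X : T -> R) : Prop :=
  (\sum_(1 <= k <oo) (moment P X k `^ (2 * k%:R)^-1%R)^-1 = +oo)%E.

(* Uniqueness is among all Borel probability measures on the real line carried
   by [0, +oo[, not only among laws of random variables defined on T. *)
Definition M_det (d : measure_display) (T : measurableType d)
    (R : realType) (P : probability T R) (X : {RV P >-> R}) : Prop :=
  [/\ nonneg_RV P X, finite_moments P X &
    forall Q : probability (measurableTypeR R) R,
      Q [set x | 0 <= x] = 1%E ->
      (forall k : nat, (1 <= k)%N ->
        (\int[Q]_x (x ^+ k)%:E = moment P X k)%E) ->
      forall A : set (measurableTypeR R), measurable A ->
        Q A = distribution P X A].

(* Main.v *)
Require Import Defs.
From HB Require Import structures.
From mathcomp Require Import all_boot all_order all_algebra.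
From mathcomp Require Import all_classical all_reals all_analysis.
From mathcomp Require Import measurable_realfun ring lra zify.

Set Implicit Arguments.
Unset Strict Implicit.
Unset Printing Implicit Defensive.

Import Order.TTheory GRing.Theory Num.Theory.
Import numFieldNormedType.Exports.

Local Open Scope classical_set_scope.
Local Open Scope ring_scope.

(** Put n = floor a and Y = X^n.  Since n <= a, the n consecutive ratios that
    lead from m_(nk) to m_(n(k+1)) multiply up to O((k+1)^(2n/a)), which is
    O((k+1)^2), so that E[Y^k] <= (E^k k!)^2 for some constant E > 0
    ([power_moments_le]).  As k! <= k^k, the k-th term of Carleman's series is
    at least 1/(E k), and the harmonic series diverges ([carleman_series]).

    Determinacy is obtained from the same bound without Carleman's theorem.
    Let y = sqrt Y, whose even moments are the moments of Y.  The bound and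
    (k!)^2 <= (2k)! make E[exp(c y)] finite for c = 1/(2E), for Y and for every
    other law on the half-line with the same moments
    ([integrable_exp_of_even_moments]).  Thus the cosine transforms
    s |-> E[cos(s y)] of two such laws are real-analytic with a radius of
    convergence bounded below uniformly in s.  At s = 0 their Taylor
    coefficients are even moments of y, hence they agree; stepping along the
    line by a fixed length, they agree everywhere.  Products of cosines being
    sums of cosines, the two laws then integrate every polynomial in cos(s y)
    to the same value.  Explicit polynomials that converge to indicators of
    half-lines extend this to the events cos(s y) >= cos(s b); with s = pi/N
    and N growing, these events become y <= b.  So the two laws have the same
    distribution function ([even_moments_determine_norm]), and they are equal
    ([stieltjes_determinate]).

    All the passages to the limit are instances of one closure property, that
    of the functions with equal integrals under two given laws
    ([same_integral_dominated]). *)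

(** * Functions with equal integrals under two probabilities *)

Section same_integral.
Context (R : realType) (d : measure_display) (T : measurableType d).
Variables Q1 Q2 : probability T R.

(** Integrability under both measures belongs to the predicate, so that it is
    closed under linear combinations and dominated limits with no side
    condition. *)
Definition same_integral (f : T -> R) : Prop :=
  [/\ Q1.-integrable [set: T] (EFin \o f), Q2.-integrable [set: T] (EFin \o f)
    & (\int[Q1]_x (f x)%:E = \int[Q2]_x (f x)%:E)%E].

Lemma eq_same_integral (f g : T -> R) :
  f =1 g -> same_integral f -> same_integral g.
Proof. by move=> /funext ->. Qed.

Lemma same_integral_cst (r : R) : same_integral (cst r).
Proof.
split; [exact: finite_measure_integrable_cst..|].
have int_cst (Q : probability T R) : (\int[Q]_x (cst r x)%:E = r%:E)%E.
  by rewrite -[RHS](expectation_cst Q) unlock.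
by rewrite !int_cst.
Qed.

Lemma same_integralD (f g : T -> R) : same_integral f -> same_integral g ->
  same_integral (f \+ g).
Proof.
move=> [f1 f2 fE] [g1 g2 gE].
split; [exact: integrableD f1 g1|exact: integrableD f2 g2|].
by rewrite !integralD_EFin// fE gE.
Qed.

Lemma same_integralZ (r : R) (f : T -> R) : same_integral f ->
  same_integral (fun x => r * f x).
Proof.
move=> [f1 f2 fE].
split; [exact: integrableZl f1|exact: integrableZl f2|].
rewrite (integralZl measurableT f1 r) (integralZl measurableT f2 r).
by rewrite fE.
Qed.

Lemma same_integral_sum (I : Type) (s : seq I) (f : I -> T -> R) :
  (forall i, same_integral (f i)) ->
  same_integral (fun x => \sum_(i <- s) f i x).
Proof.
move=> fP; elim: s => [|i s IHs].
  by apply: eq_same_integral (same_integral_cst 0) => x; rewrite big_nil.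
apply: eq_same_integral (same_integralD (fP i) IHs) => x.
by rewrite big_cons.
Qed.

Lemma same_integral_dominated (f_ : nat -> T -> R) (f g : T -> R) :
  Q1.-integrable [set: T] (EFin \o g) -> Q2.-integrable [set: T] (EFin \o g) ->
  (forall n x, `|f_ n x| <= g x) -> (forall x, f_ ^~ x @ \oo --> f x) ->
  (forall n, same_integral (f_ n)) -> same_integral f.
Proof.
move=> g1 g2 fg ff fP.
have mf_ n : measurable_fun [set: T] (EFin \o f_ n).
  by case: (fP n) => /measurable_int.
have mf : measurable_fun [set: T] (EFin \o f).
  apply/measurable_EFinP; apply: (measurable_fun_cvg (h := f_)) => //.
  by move=> n; apply/measurable_EFinP.
have ffE x : (EFin \o f_ n) x @[n --> \oo] --> (EFin \o f) x.
  apply: cvg_EFin; [exact: nearW|exact: ff].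
have fgE n x : (`|(EFin \o f_ n) x| <= (EFin \o g) x)%E.
  by rewrite /= lee_fin.
have [i1 _ c1] := dominated_convergence measurableT mf_ mf
  (aeW _ (fun x _ => ffE x)) g1 (aeW _ (fun x n _ => fgE n x)).
have [i2 _ c2] := dominated_convergence measurableT mf_ mf
  (aeW _ (fun x _ => ffE x)) g2 (aeW _ (fun x n _ => fgE n x)).
split => //; apply: cvg_unique c1 _ => //.
rewrite (_ : [sequence _]_n =
  [sequence \int[Q2]_x (EFin \o f_ n) x]_n)%E//.
by apply/funext => n; case: (fP n).
Qed.

End same_integral.

(** * Taylor expansion of the cosine *)

Section cos_taylor.
Context (R : realType).
Implicit Types a u : R.

Lemma cosD_nat_pihalf a j : cos (a + j%:R * (pi / 2)) =
  (~~ odd j)%:R * (-1) ^+ j./2 * cos a - (odd j)%:R * (-1) ^+ j.-1./2 * sin a.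
Proof.
elim/ltn_ind: j a => -[|[|j]] IH a.
- by rewrite mul0r addr0 expr0 !mul1r !mul0r subr0.
- by rewrite mul1r cosDpihalf/= !mul0r sub0r !mul1r.
rewrite -addn2 natrD mulrDl addrA (addrAC a).
rewrite IH; last by lia.
have -> : a + 2 * (pi / 2) = a + pi by rewrite mulrC divfK.
rewrite cosDpi sinDpi addn2 /= negbK; case: j {IH} => [|j] /=.
  by rewrite !mul0r !subr0 !mul1r mulN1r.
by rewrite !negbK !exprS; ring.
Qed.

(** The j-th derivative of cos at a is cos (a + j pi / 2). *)
Definition cos_taylor_coeff a u (j : nat) : R :=
  u ^+ j / j`!%:R * cos (a + j%:R * (pi / 2)).

Lemma cvg_cos_taylor a u : series (cos_taylor_coeff a u) @ \oo --> cos (a + u).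
Proof.
have -> : series (cos_taylor_coeff a u) =
    fun n => cos a * series (cos_coeff u) n - sin a * series (sin_coeff u) n.
  apply/funext => n; rewrite /series/= !mulr_sumr -sumrB.
  apply: eq_bigr => j _; rewrite /cos_taylor_coeff cosD_nat_pihalf.
  by rewrite /cos_coeff /sin_coeff/= -!exprnP; ring.
rewrite cosD; apply: cvgB; apply: cvgMl_tmp.
- by rewrite unlock; exact: is_cvg_series_cos_coeff.
- by rewrite unlock; exact: is_cvg_series_sin_coeff.
Qed.

(** This bound, uniform in the order n of the partial sum, is what dominated
    convergence needs. *)
Lemma norm_cos_taylor_le a u n :
  `|\sum_(j <- iota 0 n) cos_taylor_coeff a u j| <= expR `|u|.
Proof.
apply: le_trans (ler_norm_sum _ _ _) _.
rewrite /expR; apply: le_trans (nondecreasing_cvgn_le _ (is_cvg_series_exp_coeff _) n).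
  rewrite /series /= /index_iota subn0; apply: ler_sum => j _.
  rewrite /cos_taylor_coeff !normrM normrX normfV normr_nat.
  by rewrite ler_piMr ?cos_max// mulr_ge0 ?invr_ge0.
apply: nondecreasing_series => j _ _.
by rewrite /exp_coeff/= divr_ge0.
Qed.

End cos_taylor.

(** * Polynomials approximating a step on the unit interval *)

Section threshold_polynomials.
Context (R : realType).
Implicit Types x t r : R.

Lemma bernoulli_lower x m : 0 <= x <= 1 -> 1 - m%:R * x <= (1 - x) ^+ m.
Proof.
move=> /andP[x0 x1]; elim: m => [|m IH]; first by rewrite mul0r subr0 expr0.
rewrite exprS -natr1; have := ler_wpM2l (_ : 0 <= 1 - x) IH.
rewrite subr_ge0 => /(_ x1); apply: le_trans.
have : 0 <= m%:R * x ^+ 2 by rewrite mulr_ge0// sqr_ge0.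
by nra.
Qed.

Lemma bernoulli_upper x m : 0 <= x <= 1 -> (1 - x) ^+ m * (1 + m%:R * x) <= 1.
Proof.
move=> /andP[x0 x1]; elim: m => [|m IH].
  by rewrite mul0r addr0 expr0 mul1r.
apply: le_trans IH; rewrite exprS (mulrC (1 - x)) -mulrA.
apply: ler_wpM2l; first by rewrite exprn_ge0// subr_ge0.
rewrite -natr1; have : 0 <= m%:R * x ^+ 2 by rewrite mulr_ge0// sqr_ge0.
by nra.
Qed.

(** With q = sqrt r, Bernoulli's inequality bounds n q^n by 1 / (1 - q), and
    the other factor q^n tends to 0. *)
Lemma cvg_natmul_expr r : 0 <= r < 1 -> n%:R * r ^+ n @[n --> \oo] --> 0.
Proof.
move=> /andP[r0 r1]; set q := Num.sqrt r.
have q0 : 0 <= q by exact: sqrtr_ge0.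
have q1 : q < 1 by rewrite -sqrtr1 ltr_sqrt.
have rq : r = q * q by rewrite -expr2 sqr_sqrtr.
apply: (@squeeze_cvgr _ _ _ _ (cst 0) (geometric (1 - q)^-1 q)); last 2 first.
- exact: cvg_cst.
- by apply: cvg_geometric; rewrite ger0_norm.
apply: nearW => n /=; rewrite mulr_ge0 ?exprn_ge0//=.
rewrite rq exprMn mulrA ler_wpM2r ?exprn_ge0//.
have /bernoulli_upper -/(_ n) : 0 <= 1 - q <= 1 by lra.
rewrite subKr => h.
rewrite -[leRHS]mul1r ler_pdivlMr ?subr_gt0//.
apply: le_trans h.
by have := exprn_ge0 n q0; nra.
Qed.

(** The exponent n 2^n makes the product of the exponent and t^n equal to
    n (2t)^n, which tends to 0 below 1/2 and is at least n from 1/2 on;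
    Bernoulli's inequalities turn this into the two limits.  The extra factor n
    settles the point t = 1/2 itself. *)
Lemma cvg_threshold t : 0 <= t <= 1 ->
  1 - (1 - t ^+ n) ^+ (n * 2 ^ n) @[n --> \oo] --> ((1 / 2 <= t)%R%:R : R).
Proof.
move=> /andP[t0 t1].
have tn n : 0 <= t ^+ n <= 1 by rewrite exprn_ge0// exprn_ile1.
have mE n : (n * 2 ^ n)%:R * t ^+ n = n%:R * (2 * t) ^+ n.
  by rewrite natrM natrX -mulrA exprMn.
have le1 n m : (1 - t ^+ n) ^+ m <= 1.
  by have /andP[? ?] := tn n; rewrite exprn_ile1//; lra.
have ge0 n m : 0 <= (1 - t ^+ n) ^+ m.
  by have /andP[? ?] := tn n; rewrite exprn_ge0//; lra.
case: (leP (1 / 2) t) => th.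
- rewrite -[X in _ --> X]subr0; apply: cvgB; first exact: cvg_cst.
  apply: (@squeeze_cvgr _ _ _ _ (cst 0) harmonic).
  + apply: nearW => n /=; rewrite ge0/=.
    rewrite -[leRHS]mul1r ler_pdivlMr// -nat1r.
    apply: le_trans (bernoulli_upper (n * 2 ^ n) (tn n)).
    apply: ler_wpM2l => //; rewrite mE lerD2l ler_peMr// exprn_ege1//; lra.
  + exact: cvg_cst.
  + exact: cvg_harmonic.
- apply: (@squeeze_cvgr _ _ _ _ (cst 0) (fun n => n%:R * (2 * t) ^+ n)).
  + apply: nearW => n /=; rewrite subr_ge0 le1/= -mE.
    by have := bernoulli_lower (n * 2 ^ n) (tn n); lra.
  + exact: cvg_cst.
  + by apply: cvg_natmul_expr; lra.
Qed.

End threshold_polynomials.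

(** * Even moments and the law of the absolute value *)

Section even_moments.
Context (R : realType) (d : measure_display) (T : measurableType d).
Variables (Q1 Q2 : probability T R) (y : T -> R) (c : R).
Hypothesis my : measurable_fun [set: T] y.
Hypothesis c_gt0 : 0 < c.
Hypothesis exp1 : Q1.-integrable [set: T] (fun x => (expR (c * `|y x|))%:E).
Hypothesis exp2 : Q2.-integrable [set: T] (fun x => (expR (c * `|y x|))%:E).
Hypothesis even : forall k, same_integral Q1 Q2 (fun x => y x ^+ k.*2).

(** The k-th derivative of s |-> cos (s y). *)
Let wave (k : nat) (s : R) (x : T) : R :=
  y x ^+ k * cos (s * y x + k%:R * (pi / 2)).

(** At s = 0 the odd derivatives vanish and the even ones are, up to sign, the
    even powers of y. *)
Let wave0 k : same_integral Q1 Q2 (wave k 0).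
Proof.
have [ek|ok] := boolP (odd k).
  apply: eq_same_integral (same_integral_cst Q1 Q2 0) => x.
  by rewrite /wave mul0r cosD_nat_pihalf ek/= sin0 !mul0r mulr0 subr0 mulr0.
have kE : k = k./2.*2 by rewrite even_halfK.
apply: eq_same_integral (same_integralZ ((-1) ^+ k./2) (even k./2)) => x.
rewrite /wave mul0r cosD_nat_pihalf (negbTE ok)/= cos0 !mul0r subr0 mulr1 mul1r.
by rewrite [in RHS]mulrC -kE.
Qed.

Let dom k (x : T) : R := k`!%:R / (c / 2) ^+ k * expR (c * `|y x|).

Let dom_int (Q : probability T R) k :
  Q.-integrable [set: T] (fun x => (expR (c * `|y x|))%:E) ->
  Q.-integrable [set: T] (EFin \o dom k).
Proof. by move=> QE; exact: (integrableZl measurableT _ QE). Qed.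

(** Half of the exponential rate c pays for the power of y, by keeping one term
    of the exponential series. *)
Let le_dom k x : `|y x| ^+ k * expR (c / 2 * `|y x|) <= dom k x.
Proof.
have c20 : 0 < c / 2 by rewrite divr_gt0.
rewrite /dom; have -> : c * `|y x| = c / 2 * `|y x| + c / 2 * `|y x| by field.
rewrite expRD mulrA ler_wpM2r ?expR_ge0//.
rewrite mulrAC ler_pdivlMr ?exprn_gt0// [leLHS]mulrC -exprMn.
rewrite [leRHS]mulrC -ler_pdivrMr ?ltr0n ?fact_gt0//.
have : 0 <= c / 2 * `|y x| by rewrite mulr_ge0// ltW.
case: k => [|k] h; first by rewrite expr0 fact0 divr1 -[leLHS]expR0 ler_expR.
by apply: le_trans (expR_ge1Dxn k h); rewrite lerDr.
Qed.

(** Analytic continuation by a step whose length does not depend on s: the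
    Taylor series of the k-th derivative at s only involves higher derivatives
    at s, and its partial sums are dominated by |y|^k exp(c |y| / 2). *)
Let wave_step (s u : R) : `|u| <= c / 2 ->
  (forall k, same_integral Q1 Q2 (wave k s)) ->
  forall k, same_integral Q1 Q2 (wave k (s + u)).
Proof.
move=> uc ws k.
pose f n x := y x ^+ k *
  series (cos_taylor_coeff (s * y x + k%:R * (pi / 2)) (u * y x)) n.
apply: (@same_integral_dominated _ _ _ _ _ f _ (dom k)).
- exact: dom_int.
- exact: dom_int.
- move=> n x; rewrite /f normrM normrX.
  apply: le_trans (le_dom k x); rewrite ler_wpM2l ?exprn_ge0//.
  have := norm_cos_taylor_le (s * y x + k%:R * (pi / 2)) (u * y x) n.
  rewrite /series/= /index_iota subn0 => /le_trans; apply.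
  by rewrite ler_expR normrM ler_wpM2r.
- move=> x; rewrite /f /wave; apply: cvgMl_tmp.
  rewrite (_ : (s + u) * y x + k%:R * (pi / 2) =
     s * y x + k%:R * (pi / 2) + u * y x); last by ring.
  exact: cvg_cos_taylor.
- move=> n; have := same_integral_sum (index_iota 0 n)
    (fun j => same_integralZ (u ^+ j / j`!%:R) (ws (k + j)%N)).
  apply: eq_same_integral => x; rewrite /f /series/= mulr_sumr.
  apply: eq_bigr => j _; rewrite /wave /cos_taylor_coeff exprD exprMn natrD.
  by rewrite -addrA mulrDl; ring.
Qed.

Let wave_all (s : R) k : same_integral Q1 Q2 (wave k s).
Proof.
have c20 : 0 < c / 2 by rewrite divr_gt0.
(* N steps of length at most c / 2 lead from 0 to s. *)
pose N := (Num.bound (s / (c / 2))).+1.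
pose u := s / N%:R.
have uc : `|u| <= c / 2.
  rewrite /u normrM normfV normr_nat ler_pdivrMr ?ltr0n// mulrC.
  rewrite -ler_pdivrMr//.
  have := unstable.ltr_norm_bound (s / (c / 2)).
  rewrite normrM normfV (gtr0_norm c20) => /ltW/le_trans; apply.
  by rewrite ler_nat.
have sE : s = N%:R * u by rewrite /u mulrC divfK// pnatr_eq0.
rewrite sE; move: N u uc {sE} => N u uc; elim: N k => [|n IH] k; first by rewrite mul0r.
by rewrite -natr1 mulrDl mul1r; apply: wave_step.
Qed.

Let cos_same (s : R) : same_integral Q1 Q2 (fun x => cos (s * y x)).
Proof.
apply: eq_same_integral (wave_all s 0) => x.
by rewrite /wave mul1r mul0r addr0.
Qed.

(** Induction on k by the product formula for cosines; the factor
    [cos (t * y x)] is there to carry it. *)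
Let cosX_same k (s t : R) :
  same_integral Q1 Q2 (fun x => cos (s * y x) ^+ k * cos (t * y x)).
Proof.
elim: k t => [|k IH] t.
  by apply: eq_same_integral (cos_same t) => x; rewrite mul1r.
have := same_integralZ (1 / 2) (same_integralD (IH (t + s)) (IH (t - s))).
apply: eq_same_integral => x /=.
by rewrite !mulrDl mulNr cosD cosB exprS; field.
Qed.

Let horner_cos_same (p : {poly R}) (s : R) :
  same_integral Q1 Q2 (fun x => p.[cos (s * y x)]).
Proof.
have := same_integral_sum (index_enum 'I_(size p))
  (fun i => same_integralZ p`_i (cosX_same i s 0)).
apply: eq_same_integral => x; rewrite horner_coef.
by apply: eq_bigr => i _; rewrite mul0r cos0 mulr1.
Qed.

(** The affine map z |-> (z + 2 - b) / 4 sends [-1, 1] into [0, 1] and b to the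
    threshold 1/2. *)
Let level_cos_same (s b : R) : -1 <= b <= 1 ->
  same_integral Q1 Q2 (fun x => (b <= cos (s * y x))%R%:R).
Proof.
move=> b1.
pose p n : {poly R} := 1 - (1 - (4^-1 *: ('X + (2 - b)%:P)) ^+ n) ^+ (n * 2 ^ n).
pose t x := 4^-1 * (cos (s * y x) + (2 - b)).
have pE n x : (p n).[cos (s * y x)] = 1 - (1 - t x ^+ n) ^+ (n * 2 ^ n).
  by rewrite /p /t !(hornerE, horner_exp).
have t01 x : 0 <= t x <= 1.
  by rewrite /t; have := cos_geN1 (s * y x); have := cos_le1 (s * y x); lra.
apply: (@same_integral_dominated _ _ _ _ _
  (fun n x => (p n).[cos (s * y x)]) _ (cst 1)).
- exact: finite_measure_integrable_cst.
- exact: finite_measure_integrable_cst.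
- move=> n x; rewrite pE /=; have /andP[t0 t1] := t01 x.
  have ht : 0 <= t x ^+ n <= 1 by rewrite exprn_ge0// exprn_ile1.
  have : 0 <= (1 - t x ^+ n) ^+ (n * 2 ^ n) <= 1.
    by apply/andP; split; [apply: exprn_ge0|apply: exprn_ile1]; lra.
  by rewrite ler_norml; lra.
- move=> x; rewrite (_ : (b <= cos (s * y x)) = (1 / 2 <= t x)); last first.
    by apply/idP/idP; rewrite /t; lra.
  have := cvg_threshold (t01 x); apply: cvg_trans; apply: near_eq_cvg.
  by apply: nearW => n; rewrite pE.
- by move=> n; exact: horner_cos_same.
Qed.

(** As soon as n >= b + |y x|, both b pi/(n+1) and |y x| pi/(n+1) lie in
    [0, pi], where cos decreases: the event that compares their cosines is then
    the event |y| <= b. *)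
Lemma even_moments_determine_norm (b : R) : 0 <= b ->
  Q1 [set x | `|y x| <= b] = Q2 [set x | `|y x| <= b].
Proof.
move=> b0.
have pi0 : 0 < pi :> R := pi_gt0 R.
pose s n : R := pi / n.+1%:R.
have : same_integral Q1 Q2 (fun x => (`|y x| <= b)%R%:R).
  apply: (@same_integral_dominated _ _ _ _ _
    (fun n x => (cos (s n * b) <= cos (s n * y x))%R%:R) _ (cst 1)).
  - exact: finite_measure_integrable_cst.
  - exact: finite_measure_integrable_cst.
  - by move=> n x; rewrite normr_nat lern1 leq_b1.
  - move=> x; apply: cvg_near_cst.
    have [N _ hN] := nbhs_infty_gtr (b + `|y x|).
    exists N => // n /= Nn.
    have {}hN := hN n Nn.
    have s0 : 0 < s n by rewrite divr_gt0.
    have in0pi (z : R) : 0 <= z -> z <= b + `|y x| -> s n * z \in `[0, pi].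
      move=> z0 zb; rewrite in_itv/= mulr_ge0 ?(ltW s0)//=.
      rewrite /s mulrAC ler_pdivrMr ?ltr0n// ler_wpM2l ?(ltW pi0)//.
      rewrite (le_trans zb)// (le_trans (ltW hN))// ler_nat//.
    rewrite -[cos (s n * y x)]cos_norm normrM (gtr0_norm s0).
    rewrite leNgt ltr_cos; [|apply: in0pi|apply: in0pi] => //.
    + by rewrite -leNgt ler_pM2l.
    + by rewrite lerDl.
    + by rewrite lerDr.
  - by move=> n; apply: level_cos_same; rewrite cos_geN1 cos_le1.
have mA : measurable [set x | `|y x| <= b].
  have mn : measurable_fun [set: T] (fun x => `|y x|).
    exact: measurableT_comp (@normr_measurable R setT) my.
  rewrite (_ : [set x | _] = (fun x => `|y x|) @^-1` `]-oo, b]); last first.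
    by apply/seteqP; split => x /=; rewrite in_itv.
  by rewrite -[X in measurable X]setTI; exact: mn.
have E (Q : probability T R) :
    (\int[Q]_x ((`|y x| <= b)%R%:R)%:E)%E = Q [set x | `|y x| <= b].
  have := integral_indic Q measurableT mA; rewrite setIT => <-.
  by apply: eq_integral => x _; rewrite indicE mem_setE.
by case=> _ _; rewrite !E.
Qed.

End even_moments.

(** * Exponential moments from moment bounds *)

Lemma fact_sqr_le k : (k`! * k`! <= (k.*2)`!)%N.
Proof.
have kk : (k <= k.*2)%N by rewrite -addnn leq_addr.
rewrite -(bin_fact kk) -addnn addnK leq_pmull// bin_gt0 addnn.
exact: kk.
Qed.

Section exponential_moment.
Context (R : realType) (d : measure_display) (T : measurableType d).
Variables (Q : probability T R) (y : T -> R) (E : R).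
Hypothesis my : measurable_fun [set: T] y.
Hypothesis E_gt0 : 0 < E.
Hypothesis moments_le : forall k,
  (\int[Q]_x (y x ^+ k.*2)%:E <= ((E ^+ k * k`!%:R) ^+ 2)%:E)%E.

Let c := (2 * E)^-1.
Let u x := c * `|y x|.
(** The terms of the power series of 2 cosh (u x): they are nonnegative, and
    only even moments of y enter their integrals. *)
Let h j x : R := exp_coeff (u x) j + exp_coeff (- u x) j.

Let c_gt0 : 0 < c. Proof. by rewrite invr_gt0 mulr_gt0. Qed.

Let hE j x : h j x =
  if odd j then 0 else 2 * c ^+ j / j`!%:R * y x ^+ j.
Proof.
rewrite /h /exp_coeff/= exprNn -signr_odd; case: ifPn => [oj|/negbTE oj].
  by rewrite expr1; ring.
rewrite expr0 /u exprMn -normrX ger0_norm; first by ring.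
by rewrite exprn_even_ge0// oj.
Qed.

Let h_ge0 j x : 0 <= h j x.
Proof.
rewrite hE; case: ifPn => // oj.
rewrite mulr_ge0 ?exprn_even_ge0// divr_ge0// mulr_ge0// exprn_ge0//.
exact: ltW.
Qed.

Let mh j : measurable_fun [set: T] (EFin \o h j).
Proof.
apply/measurable_EFinP.
rewrite (_ : h j = fun x => if odd j then 0 else 2 * c ^+ j / j`!%:R * y x ^+ j).
  case: (odd j); first exact: measurable_cst.
  by apply: measurable_funM => //; exact: measurable_funX.
by apply/funext => x; exact: hE.
Qed.

(** The even term j = 2k is at most 2 (cE)^j (k!)^2 / (2k)!, with cE = 1/2; the
    bound is written in the form of the library's geometric series. *)
Let int_h_le j : (\int[Q]_x (h j x)%:E <= (4 / (2 ^ (j + 1))%:R)%:E)%E.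
Proof.
under eq_integral do rewrite hE.
case: (boolP (odd j)) => oj.
  by rewrite integral0 lee_fin divr_ge0.
have jE : j = j./2.*2 by rewrite even_halfK.
set k := j./2 in jE.
under eq_integral do rewrite EFinM.
rewrite ge0_integralZl_EFin//; last 3 first.
- by move=> x _; rewrite lee_fin exprn_even_ge0.
- by apply/measurable_EFinP; exact: measurable_funX.
- by rewrite divr_ge0// mulr_ge0// exprn_ge0// ltW.
rewrite [in X in (_ * X)%E]jE.
apply: (@le_trans _ _ ((2 * c ^+ j / j`!%:R)%:E * ((E ^+ k * k`!%:R) ^+ 2)%:E)%E).
  apply: lee_wpmul2l; last exact: moments_le.
  by rewrite lee_fin divr_ge0// mulr_ge0// exprn_ge0// ltW.
rewrite -EFinM lee_fin.
have -> : 2 * c ^+ j / j`!%:R * (E ^+ k * k`!%:R) ^+ 2 =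
    2 * (c * E) ^+ j * ((k`! * k`!)%:R / j`!%:R).
  by rewrite !exprMn -exprM muln2 -jE natrM; ring.
have -> : c * E = 2^-1 by rewrite /c invfM -mulrA mulVf ?mulr1// gt_eqF.
rewrite addn1 natrX exprS exprVn.
have -> : 4 / (2 * 2 ^+ j) = 2 * (2 ^+ j)^-1 :> R.
  by field; rewrite expf_neq0.
rewrite ler_piMr//.
rewrite ler_pdivrMr ?ltr0n ?fact_gt0// mul1r ler_nat [leqRHS](congr1 _ jE).
exact: fact_sqr_le.
Qed.

(** The moment bound is Hardy's condition in disguise: integrate the series of
    2 cosh (c |y|), which dominates exp (c |y|), term by term. *)
Lemma integrable_exp_of_even_moments :
  Q.-integrable [set: T] (fun x => (expR (c * `|y x|))%:E).
Proof.
have mu_ : measurable_fun [set: T] u.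
  by apply: measurable_funM => //; exact: measurableT_comp.
apply/integrableP; split.
  by apply/measurable_EFinP; exact: measurableT_comp.
have sE x : (\sum_(0 <= j <oo) (h j x)%:E = (expR (u x) + expR (- u x))%:E)%E.
  apply: cvg_lim => //.
  under eq_fun do rewrite sumEFin.
  apply: cvg_EFin; first exact: nearW.
  rewrite (_ : fine \o _ = series (exp_coeff (u x)) \+ series (exp_coeff (- u x))).
    by apply: cvgD; exact: is_cvg_series_exp_coeff.
  by apply/funext => n /=; rewrite /series/= -big_split.
apply: (@le_lt_trans _ _ (\int[Q]_x (\sum_(0 <= j <oo) (h j x)%:E))%E).
  apply: ge0_le_integral => //.
  - by apply/measurable_EFinP; apply: measurableT_comp => //; exact: measurableT_comp.
  - under eq_fun do rewrite sE.
    apply/measurable_EFinP; apply: measurable_funD.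
      exact: measurableT_comp.
    by apply: measurableT_comp => //; exact: measurableT_comp.
  - move=> x _; rewrite sE lee_fin ger0_norm ?expR_ge0// lerDl.
    exact: expR_ge0.
rewrite integral_nneseries//; last by move=> j x _; rewrite lee_fin.
apply: (@le_lt_trans _ _ (\sum_(0 <= j <oo) (4 / (2 ^ (j + 1))%:R)%:E)%E).
  apply: lee_nneseries => // j _ _.
  by apply: integral_ge0 => x _; rewrite lee_fin.
have /cvg_lim -> // := @cvg_geometric_eseries_half R 4 0.
exact: ltry.
Qed.

End exponential_moment.

(** * The Stieltjes moment problem *)

Section stieltjes.
Context (R : realType).

Lemma probability_eq_rays (Q1 Q2 : probability (measurableTypeR R) R) :
  (forall r, Q1 `]-oo, r]%classic = Q2 `]-oo, r]%classic) ->
  forall A : set (measurableTypeR R), measurable A -> Q1 A = Q2 A.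
Proof.
move=> Q12; apply: (@measure_unique _ R (measurableTypeR R) (@RGenOInfty.G R)
  (fun n => `]- n%:R, +oo[%classic)).
- exact: RGenOInfty.measurableE.
- move=> _ _ [a ->] [b ->]; exists (Num.max a b); apply/seteqP.
  by split=> x /=; rewrite !in_itv/= !andbT gt_max => /andP.
- by move=> n; exists (- n%:R).
- apply/seteqP; split => // x _; exists (Num.bound x) => //=.
  rewrite in_itv/= andbT ltrNl; exact: unstable.ltrNbound.
- move=> _ [r ->]; rewrite -setCitvl.
  have QC (Q : probability (measurableTypeR R) R) :
      (Q (~` `]-oo, r]%classic) = 1 - Q `]-oo, r]%classic)%E.
    by apply: probability_setC; exact: measurable_itv.
  by apply: etrans (QC Q1) _; rewrite Q12 -QC.
- by move=> n; rewrite ltey_eq fin_num_measure.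
Qed.

(** The growth condition passes from [Q1] to [Q2], as the moments coincide.
    The result on even moments is applied to
    [Num.sqrt], which is 0 on the negative axis, a null set for both. *)
Lemma stieltjes_determinate (Q1 Q2 : probability (measurableTypeR R) R) (E : R) :
  0 < E ->
  Q1 [set x | 0 <= x] = 1%E -> Q2 [set x | 0 <= x] = 1%E ->
  (forall k, (\int[Q1]_x (x ^+ k)%:E = \int[Q2]_x (x ^+ k)%:E)%E) ->
  (forall k, (\int[Q1]_x (x ^+ k)%:E <= ((E ^+ k * k`!%:R) ^+ 2)%:E)%E) ->
  forall A : set (measurableTypeR R), measurable A -> Q1 A = Q2 A.
Proof.
move=> E0 Q10 Q20 Q12 Q1E; apply: probability_eq_rays => r.
pose y (x : measurableTypeR R) : R := Num.sqrt x.
have my : measurable_fun [set: measurableTypeR R] y.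
  by apply: continuous_measurable_fun; exact: sqrt_continuous.
have mneg : measurable [set x : measurableTypeR R | x < 0].
  rewrite (_ : mkset _ = `]-oo, 0[%classic); first exact: measurable_itv.
  by apply/seteqP; split => x /=; rewrite in_itv.
have neg0 (Q : probability (measurableTypeR R) R) :
    Q [set x | 0 <= x] = 1%E -> Q [set x | x < 0] = 0%E.
  move=> Q0; rewrite (_ : [set x | x < 0] = ~` [set x | 0 <= x]); last first.
    by apply/seteqP; split => x /=; rewrite ltNge => /negP.
  rewrite probability_setC ?Q0 ?subee//.
  rewrite (_ : mkset _ = ~` [set x : measurableTypeR R | x < 0]).
    exact: measurableC.
  by apply/seteqP; split => x /=; rewrite leNgt => /negP.
have momE (Q : probability (measurableTypeR R) R) k :
    Q [set x | 0 <= x] = 1%E ->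
    (\int[Q]_x (y x ^+ k.*2)%:E = \int[Q]_x (x ^+ k)%:E)%E.
  move=> Q0; apply: ae_eq_integral => //.
  - by apply/measurable_EFinP; exact: measurable_funX.
  - apply/measurable_EFinP; apply: measurable_funX; exact: measurable_id.
  - exists [set x | x < 0]; split => //; first exact: neg0.
    move=> x /= /not_implyP [_]; rewrite ltNge => h; apply/negP => x0; apply: h.
    by rewrite -muln2 mulnC exprM sqr_sqrtr.
have mom_le (Q : probability (measurableTypeR R) R) :
    Q [set x | 0 <= x] = 1%E ->
    (forall k, (\int[Q1]_x (x ^+ k)%:E = \int[Q]_x (x ^+ k)%:E)%E) ->
    forall k, (\int[Q]_x (y x ^+ k.*2)%:E <= ((E ^+ k * k`!%:R) ^+ 2)%:E)%E.
  by move=> Q0 QE k; rewrite momE// -QE.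
have m1 := mom_le Q1 Q10 (fun k => erefl).
have m2 := mom_le Q2 Q20 Q12.
have mom_int (Q : probability (measurableTypeR R) R) :
    (forall k, (\int[Q]_x (y x ^+ k.*2)%:E <= ((E ^+ k * k`!%:R) ^+ 2)%:E)%E) ->
    forall k, Q.-integrable setT (fun x => (y x ^+ k.*2)%:E).
  move=> QE k; apply/integrableP; split.
    by apply/measurable_EFinP; exact: measurable_funX.
  under eq_integral => x _ do rewrite gee0_abs ?lee_fin ?exprn_ge0 ?sqrtr_ge0//.
  by apply: le_lt_trans (QE k) _; rewrite ltry.
have [r0|r0] := leP 0 r; last first.
  have sub : `]-oo, r]%classic `<=` [set x : measurableTypeR R | x < 0].
    by move=> x /=; rewrite in_itv/= => /le_lt_trans; apply.
  have ray0 (Q : probability (measurableTypeR R) R) :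
      Q [set x | 0 <= x] = 1%E -> Q `]-oo, r]%classic = 0%E.
    move=> Q0; apply/eqP; rewrite -measure_le0 -(neg0 Q Q0).
    by apply: le_measure => //; rewrite inE.
  by rewrite !ray0.
have -> : `]-oo, r]%classic = [set x | `|y x| <= Num.sqrt r].
  apply/seteqP; split => x /=; rewrite in_itv/= ger0_norm ?sqrtr_ge0//.
    by rewrite /y ler_sqrt.
  by rewrite /y ler_sqrt.
apply: (even_moments_determine_norm my (c := (2 * E)^-1)).
- by rewrite invr_gt0 mulr_gt0.
- exact: integrable_exp_of_even_moments.
- exact: integrable_exp_of_even_moments.
- move=> k; split; [exact: mom_int|exact: mom_int|].
  by rewrite !momE.
- exact: sqrtr_ge0.
Qed.

End stieltjes.

(** * Growth of moments and Carleman's series *)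

Section moment_growth.
Context (R : realType).
Implicit Types (m : nat -> R) (a E : R).

(** The asymptotic bound holds at every index after the finitely many
    exceptional ratios are added to the constant, because (k+1)^(2/a) >= 1.
    Positivity matters here: a ratio with denominator 0 would be 0 and would
    bound nothing. *)
Lemma ratio_growth_all m a : (forall k, 0 < m k) ->
  (fun k => m k.+1 / m k : R^o) =O_\oo (fun k => k.+1%:R `^ (2 / a) : R^o) ->
  0 < a ->
  exists2 C, 1 <= C & forall k, m k.+1 <= C * k.+1%:R `^ (2 / a) * m k.
Proof.
move=> m0 /eqO_exP[K K0 [N _ hN]] a0.
pose S := \sum_(i < N) m i.+1 / m i.
have S0 : 0 <= S by apply: sumr_ge0 => i _; rewrite divr_ge0// ltW.
have p1 k : 1 <= k.+1%:R `^ (2 / a) :> R.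
  rewrite -[leLHS](powRr0 k.+1%:R) ler_powR ?ler1n//.
  by rewrite divr_ge0// ltW.
exists (1 + K + S); first by lra.
move=> k; rewrite -ler_pdivrMr//.
have [kN|Nk] := ltnP k N; last first.
  apply: le_trans (ler_norm _) _; apply: le_trans (hN k Nk) _.
  rewrite [X in K * X]ger0_norm ?powR_ge0//.
  by rewrite ler_wpM2r ?powR_ge0//; lra.
have : m k.+1 / m k <= S.
  rewrite /S (bigD1 (Ordinal kN))//= lerDl.
  by apply: sumr_ge0 => i _; rewrite divr_ge0// ltW.
by have := p1 k; nra.
Qed.

(** Each of the n ratios in the block from n k to n (k+1) is at most
    F k = C (n (k+1))^(2/a), and F k ^ n <= C^n (n (k+1))^2 because n <= a.
    Since C >= 1, the constant C^n n absorbs the remaining factors. *)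
Lemma power_moments_le m a (n : nat) : m 0 = 1 -> (forall k, 0 < m k) ->
  (0 < n)%N -> n%:R <= a ->
  (fun k => m k.+1 / m k : R^o) =O_\oo (fun k => k.+1%:R `^ (2 / a) : R^o) ->
  exists2 E, 0 < E & forall k, m (n * k)%N <= (E ^+ k * k`!%:R) ^+ 2.
Proof.
move=> m0 m_gt0 n0 na growth.
have a0 : 0 < a by apply: lt_le_trans na; rewrite ltr0n.
have [C C1 mC] := ratio_growth_all m_gt0 growth a0.
have C0 : 0 < C by apply: lt_le_trans C1.
pose F k : R := C * (n * k.+1)%:R `^ (2 / a).
have F0 k : 0 <= F k by rewrite mulr_ge0 ?powR_ge0// ltW.
have block k j : (j <= n)%N -> m (n * k + j)%N <= F k ^+ j * m (n * k)%N.
  elim: j => [|j IH] jn; first by rewrite addn0 mul1r.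
  rewrite addnS; apply: le_trans (mC _) _.
  rewrite exprS -(mulrA (F k)); apply: ler_pM; last exact: IH (ltnW jn).
  - by rewrite mulr_ge0 ?powR_ge0// ltW.
  - exact: ltW.
  - rewrite ler_wpM2l ?(ltW C0)// ge0_ler_powR ?nnegrE//.
      by rewrite divr_ge0// ltW.
    by rewrite ler_nat mulnS addnC; lia.
have Fn k : F k ^+ n <= (C ^+ n * n%:R * k.+1%:R) ^+ 2.
  have nk1 : 1 <= (n * k.+1)%:R :> R by rewrite ler1n muln_gt0 n0.
  rewrite exprMn -[(_ `^ _) ^+ n]powR_mulrn ?powR_ge0// -powRrM.
  apply: (@le_trans _ _ (C ^+ n * (n * k.+1)%:R ^+ 2)).
    rewrite ler_wpM2l ?exprn_ge0 ?(ltW C0)//.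
    rewrite -[_ ^+ 2]powR_mulrn// ler_powR//.
    by rewrite mulrAC ler_pdivrMr// ler_wpM2l.
  rewrite -mulrA -natrM [leRHS]exprMn ler_wpM2r ?sqr_ge0//.
  by rewrite expr2 ler_peMl ?exprn_ge0 ?exprn_ege1 ?(ltW C0).
exists (C ^+ n * n%:R); first by rewrite mulr_gt0 ?exprn_gt0 ?ltr0n.
elim=> [|k IH]; first by rewrite muln0 m0 expr0 mul1r expr1n.
rewrite mulnSr; apply: le_trans (block k n (leqnn n)) _.
move: (C ^+ n * n%:R) (Fn k) IH => D FD IH.
rewrite factS natrM.
have -> : (D ^+ k.+1 * (k.+1%:R * k`!%:R)) ^+ 2 =
    (D * k.+1%:R) ^+ 2 * (D ^+ k * k`!%:R) ^+ 2.
  by rewrite -exprMn; congr (_ ^+ 2); rewrite exprS; ring.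
by apply: ler_pM => //; [exact: exprn_ge0|exact: ltW].
Qed.

Lemma nneseries_harmonic :
  (\sum_(0 <= k <oo) (k.+1%:R^-1 : R)%:E)%E = +oo%E.
Proof.
apply: cvg_lim => //; under eq_fun do rewrite sumEFin.
apply/cvgeryP; apply: nondecreasing_dvgn_lt; last exact: dvg_harmonic.
apply/nondecreasing_seqP => n; rewrite big_nat_recr//= lerDl.
by rewrite invr_ge0.
Qed.

(** Both sides of M k <= (E^k k!)^2 <= (E k)^(2k) are raised to the power
    1/(2k); M k = 0 is harmless since the term is then infinite. *)
Lemma carleman_series (M : nat -> R) E : 0 < E -> (forall k, 0 <= M k) ->
  (forall k, M k <= (E ^+ k * k`!%:R) ^+ 2) ->
  (\sum_(1 <= k <oo) ((M k)%:E `^ (2 * k%:R)^-1%R)^-1 = +oo)%E.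
Proof.
move=> E0 M0 ME.
rewrite -nneseries_addn; last first.
  by move=> k; rewrite inve_ge0 poweR_ge0.
apply/eqP; rewrite -leye_eq.
apply: (@le_trans _ _ (\sum_(0 <= k <oo) (E^-1%:E * (k.+1%:R^-1 : R)%:E))%E).
  rewrite nneseriesZl; last by move=> k _; rewrite lee_fin invr_ge0.
  by rewrite nneseries_harmonic gt0_muley// lte_fin invr_gt0.
apply: lee_nneseries => [k _ _|k _].
  by rewrite -EFinM lee_fin mulr_ge0// invr_ge0// ltW.
rewrite addn1 poweR_EFin.
have Ek0 : 0 < E * k.+1%:R by rewrite mulr_gt0// ltr0n.
have -> : (E^-1%:E * (k.+1%:R^-1)%:E = (E * k.+1%:R)%:E^-1)%E.
  by rewrite inver gt_eqF// -EFinM invfM.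
rewrite lee_pV2 ?inE ?lee_fin ?powR_ge0 ?(ltW Ek0)//.
have -> : E * k.+1%:R = ((E * k.+1%:R) ^+ (2 * k.+1)) `^ (2 * k.+1%:R)^-1.
  by rewrite -powR_mulrn ?(ltW Ek0)// -powRrM natrM mulfV ?powRr1 ?(ltW Ek0).
apply: ge0_ler_powR; rewrite ?nnegrE ?invr_ge0 ?mulr_ge0 ?exprn_ge0 ?(ltW Ek0)//.
apply: le_trans (ME _) _; rewrite mulnC exprM.
rewrite lerXn2r ?nnegrE ?mulr_ge0 ?exprn_ge0 ?mulr_ge0 ?(ltW E0)// exprMn.
rewrite ler_wpM2l ?exprn_ge0 ?(ltW E0)// -natrX ler_nat.
elim: {Ek0}k.+1 => [//|j IH]; rewrite factS expnS leq_mul2l /=.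
by apply: leq_trans IH _; case: j => // j; rewrite leq_exp2r.
Qed.

End moment_growth.

(** * Moments of powers of a nonnegative random variable *)

Section moments_of_powers.
Context (R : realType) (d : measure_display) (T : measurableType d).
Variables (P : probability T R) (X : {RV P >-> R}).
Hypothesis X_ge0 : nonneg_RV P X.
Hypothesis X_moments : finite_moments P X.

Lemma momentE (Y : T -> R) k : moment P Y k = (\int[P]_t (Y t ^+ k)%:E)%E.
Proof. by rewrite /moment unlock. Qed.

Lemma moment0 (Y : T -> R) : moment P Y 0 = 1%E.
Proof.
rewrite /moment (_ : (fun t => Y t ^+ 0) = cst 1); last by apply/funext.
by rewrite expectation_cst.
Qed.

Lemma moment_power_RV n k : moment P (power_RV X n) k = moment P X (n * k)%N.
Proof.
by congr ('E_P[_])%E; apply/funext => t; rewrite /power_RV exprM.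
Qed.

Lemma nonneg_power_RV n : nonneg_RV P (power_RV X n).
Proof. by apply: filterS X_ge0 => t Xt; exact: exprn_ge0. Qed.

Lemma integrable_powers k : P.-integrable [set: T] (fun t => (X t ^+ k)%:E).
Proof.
case: k => [|k]; last exact: X_moments.
exact: (finite_measure_integrable_cst P 1).
Qed.

Lemma moment_fin_num k : moment P X k \is a fin_num.
Proof. by rewrite momentE; exact: integrable_fin_num (integrable_powers k). Qed.

Lemma integral_norm_powers k :
  (\int[P]_t `|(X t ^+ k)%:E| = moment P X k)%E.
Proof.
rewrite momentE; apply: ae_eq_integral => //.
- by apply: measurableT_comp => //; exact: measurable_int (integrable_powers k).
- exact: measurable_int (integrable_powers k).
- by apply: filterS X_ge0 => t Xt _; rewrite gee0_abs// lee_fin exprn_ge0.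
Qed.

(** If E[X^k] vanished, then X would be 0 almost surely, against E[X] > 0.
    For k = 0 this reads 1 = 0 almost surely, and the same argument applies. *)
Lemma moment_gt0 k : (0 < moment P X 1)%E -> (0 < moment P X k)%E.
Proof.
move=> m1; rewrite lt0e; apply/andP; split; last first.
  by rewrite -integral_norm_powers; exact: integral_ge0.
apply: contraL m1 => /eqP; rewrite -integral_norm_powers.
move/(ae_eq_integral_abs P measurableT (measurable_int _ (integrable_powers k))).
move=> Xk0; rewrite momentE (_ : (\int[P]_t _)%E = 0%E) ?ltxx//.
rewrite -[RHS](integral0 P [set: T]); apply: ae_eq_integral => //.
  exact: measurable_int (integrable_powers 1).
apply: filterS Xk0 => t /[apply] -[] /eqP.
by rewrite expf_eq0 => /andP[_ /eqP ->]; rewrite expr1.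
Qed.

End moments_of_powers.

(** [R] and [measurableTypeR R] carry the same Borel sets through distinct
    structures, so that the type checker keeps probabilities on them apart;
    the law of [Y] is rebuilt on the latter, where uniqueness is stated. *)
Section borel_line_copy.
Context (R : realType) (d : measure_display) (T : measurableType d).
Variables (P : probability T R) (Y : {RV P >-> R}).

Definition to_borel_line (t : T) : measurableTypeR R := Y t.

Let measurable_to_borel_line : measurable_fun [set: T] to_borel_line.
Proof. exact: (measurable_funPT Y). Qed.

HB.instance Definition _ :=
  isMeasurableFun.Build _ _ _ _ to_borel_line measurable_to_borel_line.

Definition law : probability (measurableTypeR R) R :=
  distribution P (to_borel_line : {RV P >-> measurableTypeR R}).

Lemma lawE A : law A = distribution P Y A.
Proof. by []. Qed.

Lemma integral_law k : P.-integrable [set: T] (fun t => (Y t ^+ k)%:E) ->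
  (\int[law]_x (x ^+ k)%:E = moment P Y k)%E.
Proof.
move=> Yk; rewrite momentE.
rewrite (@integral_distribution _ _ _ _ _ P
  (to_borel_line : {RV P >-> measurableTypeR R}) (fun x => (x ^+ k)%:E))//.
by apply/measurable_EFinP; apply: measurable_funX; exact: measurable_id.
Qed.

End borel_line_copy.

(** The total mass of the half-line under the law of [Y] comes from the almost
    sure nonnegativity of [Y]; the moment of order 0, absent from the
    hypotheses on [Q], is 1 for every probability. *)
Lemma M_det_of_moment_bound (R : realType) (d : measure_display)
    (T : measurableType d) (P : probability T R) (Y : {RV P >-> R}) (E : R) :
  nonneg_RV P Y -> finite_moments P Y -> 0 < E ->
  (forall k, (moment P Y k <= ((E ^+ k * k`!%:R) ^+ 2)%:E)%E) -> M_det Y.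
Proof.
move=> Y0 Ym E0 YE; split => // Q Q0 QY A mA; apply/esym.
have distE k : (\int[law Y]_x (x ^+ k)%:E = moment P Y k)%E.
  by apply: integral_law; exact: integrable_powers.
rewrite -lawE.
apply: (@stieltjes_determinate R (law Y) Q E) => //.
- have mY : measurable (Y @^-1` [set x | 0 <= x]).
    rewrite -[X in measurable X]setTI; apply: (measurable_funPT Y) => //.
    rewrite (_ : mkset _ = `[0, +oo[%classic); first exact: measurable_itv.
    by apply/seteqP; split => x /=; rewrite in_itv/= andbT.
  rewrite lawE /distribution /pushforward/=.
  case: Y0 => N [mN PN subN].
  apply/eqP; rewrite eq_le probability_le1//=.
  rewrite -[leLHS](sube0 1%E) -PN -probability_setC//.
  apply: le_measure; rewrite ?inE//; first exact: measurableC.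
  by move=> t /= Nt; apply: contrapT => h; apply: Nt; apply: subN.
- move=> k; rewrite distE; case: k => [|k]; last by rewrite QY.
  rewrite moment0; under eq_integral do rewrite expr0.
  by rewrite -[LHS](expectation_cst Q) unlock.
- by move=> k; rewrite distE.
Qed.

Theorem mainTheorem2 (R : realType) (d : measure_display)
    (T : measurableType d) (P : probability T R) (X : {RV P >-> R}) (a : R)
    (X_ge0 : nonneg_RV P X)
    (X_moments : finite_moments P X)
    (m1_gt0 : (0 < moment P X 1)%E)
    (a_ge1 : 1 <= a)
    (growth : (fun k : nat => fine (moment P X k.+1) / fine (moment P X k) : R^o)
       =O_\oo (fun k : nat => k.+1%:R `^ (2 / a) : R^o)) :
  carleman P (power_RV X `|Num.floor a|%N) /\
  M_det (power_RV X `|Num.floor a|%N : {RV P >-> R}).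
Proof.
set n := `|Num.floor a|%N.
have nE : n%:Z = Num.floor a.
  by rewrite /n gez0_abs// floor_ge0 (le_trans _ a_ge1).
have n_gt0 : (0 < n)%N.
  by have : 1 <= Num.floor a; [rewrite floor_ge_int|lia].
have na : n%:R <= a by rewrite -[n%:R]/(n%:Z%:~R) nE floor_le.
have mE k : moment P X k = (fine (moment P X k))%:E.
  by rewrite fineK// moment_fin_num.
have m_gt0 k : 0 < fine (moment P X k).
  by rewrite -lte_fin -mE; exact: moment_gt0.
have m0 : fine (moment P X 0) = 1 by rewrite moment0.
have [E E0 mE_le] := power_moments_le m0 m_gt0 n_gt0 na growth.
have Ym k : moment P (power_RV X n) k = (fine (moment P X (n * k)))%:E.
  by rewrite moment_power_RV -mE.
split.
- rewrite /carleman; under eq_eseriesr do rewrite Ym.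
  by apply: (carleman_series E0) => // k; exact: ltW.
- apply: (@M_det_of_moment_bound _ _ _ P _ E) => //.
  + exact: nonneg_power_RV.
  + move=> k k1; rewrite (_ : (fun _ => _) = fun t => (X t ^+ (n * k))%:E).
      exact: integrable_powers.
    by apply/funext => t; rewrite /power_RV/= -exprM.
  + by move=> k; rewrite Ym lee_fin.
Qed.
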